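(* The subgroup of $\mathcal S(\mathbb N)$ generated by $\{\alpha,\ Id\star\alpha\}$ is isomorphic to Thompson's group $\mathcal F$.
   Context: $\mathbb N=\{0,1,2,\dots\}$, $\mathcal S(\mathbb N)$ is the group of all bijections $\mathbb N\to\mathbb N$ under composition of functions, and $Id$ is its identity. The original Collatz bijection $\rho\in\mathcal S(\mathbb N)$ is given by $\rho(n)=\frac{2n}{3}$ if $n\equiv 0 \pmod 3$, $\rho(n)=\frac{4n-1}{3}$ if $n\equiv 1\pmod 3$, $\rho(n)=\frac{4n+1}{3}$ if $n\equiv 2\pmod 3$. The reduced Collatz bijection $\lambda\in\mathcal S(\mathbb N)$ is $\lambda(n)=\rho(n+1)-1$; explicitly $\lambda(n)=\frac{4n}{3}$ if $n\equiv 0\pmod 3$, $\frac{4n+2}{3}$ if $n\equiv 1\pmod 3$, $\frac{2n-1}{3}$ if $n\equiv 2\pmod 3$. The associator is $\alpha=\lambda\rho^{-1}\in\mathcal S(\mathbb N)$; explicitly $\alpha(n)=2n$ if $n$ is even, $\alpha(n)=n+1$ if $n\equiv 1\pmod 4$, $\alpha(n)=\frac{n-1}{2}$ if $n\equiv 3\pmod 4$. Girard's conjunction is the injective group homomorphism $\_\star\_:\mathcal S(\mathbb N)\times\mathcal S(\mathbb N)\to\mathcal S(\mathbb N)$ given by $(a\star b)(n)=2a\left(\frac n2\right)$ for $n$ even and $(a\star b)(n)=2b\left(\frac{n-1}{2}\right)+1$ for $n$ odd. Thompson's group $\mathcal F$ is the group presented by generators $\{x_j\}_{j\in\mathbb N}$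 and relations $x_i^{-1}x_jx_i=x_{j+1}$ for all $i<j$. *)

(* Defs.v *)
From HB Require Import structures.
From mathcomp Require Import all_boot zify.
From mathcomp Require Import boolp classical_sets.

Set Implicit Arguments.
Unset Strict Implicit.
Unset Printing Implicit Defensive.

Local Open Scope group_scope.
Local Open Scope classical_set_scope.
Local Open Scope quotient_scope.

Definition isomorphic (G H : groupType) : Prop :=
  exists f : {multiplicative G -> H}, bijective f.

Section GeneratedSubgroup.
Variables (G : groupType) (A : set G).

Definition gen_set : set G := smallest [set H | group_closed [in H]] A.

Lemma gen_set_closed : group_closed [in gen_set].
Proof.
split; first by rewrite inE => H /= [[H1 _] _]; move: H1; rewrite inE.
move=> u v; rewrite !inE => Au Av H HA; have [[_ HF] _] := HA.
have uH : u \in [in H] by rewrite inE; exact: Au.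
have vH : v \in [in H] by rewrite inE; exact: Av.
by move: (HF u v uH vH); rewrite inE.
Qed.

Definition gen_group := {x : G | x \in gen_set}.

HB.instance Definition _ := SubChoice.on gen_group.
HB.instance Definition _ :=
  SubChoice_isSubGroup.Build G [in gen_set] gen_group gen_set_closed.

End GeneratedSubgroup.

(* Words over X: the letter (x, true) stands for x and (x, false) for x^-1. *)
Definition word (X : Type) := seq (X * bool).

(* R u v is the defining relation u = v. *)
Definition relations (X : Type) := word X -> word X -> Prop.

(* The monoid congruence generated by R and free cancellation; its quotient is
   the free group on X modulo the normal closure of the u v^-1 with R u v. *)
Inductive word_eq (X : Type) (R : relations X) : word X -> word X -> Prop :=
| WordRel u v of R u v : word_eq R u v
| WordCancel x b : word_eq R [:: (x, b); (x, ~~ b)] [::]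
| WordCat u u' v v' of word_eq R u u' & word_eq R v v' :
    word_eq R (u ++ v) (u' ++ v')
| WordRefl u : word_eq R u u
| WordSym u v of word_eq R u v : word_eq R v u
| WordTrans u v w of word_eq R u v & word_eq R v w : word_eq R u w.

Definition inv_word (X : Type) (u : word X) : word X :=
  rev [seq (a.1, ~~ a.2) | a <- u].

Section PresentedGroup.
Variables (X : choiceType) (R : relations X).

Definition word_eqb : rel (word X) := fun u v => `[< word_eq R u v >].

Lemma word_eqb_refl : reflexive word_eqb.
Proof. by move=> u; apply/asboolP; exact: WordRefl. Qed.

Lemma word_eqb_sym : symmetric word_eqb.
Proof. by move=> u v; apply/asboolP/asboolP; exact: WordSym. Qed.

Lemma word_eqb_trans : transitive word_eqb.
Proof.
by move=> v u w /asboolP uv /asboolP vw; apply/asboolP; exact: WordTrans uv vw.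
Qed.

Canonical word_equiv :=
  EquivRel word_eqb word_eqb_refl word_eqb_sym word_eqb_trans.

Definition presented := {eq_quot word_eqb}.

HB.instance Definition _ := Choice.on presented.
HB.instance Definition _ := EqQuotient.on presented.

Lemma presentedP (u v : word X) :
  \pi_presented u = \pi_presented v <-> word_eq R u v.
Proof. by split=> [/eqmodP /asboolP //|uv]; apply/eqmodP/asboolP. Qed.

Definition presented_one : presented := \pi_presented [::].
Definition presented_mul (a b : presented) : presented :=
  \pi_presented (repr a ++ repr b).
Definition presented_inv (a : presented) : presented :=
  \pi_presented (inv_word (repr a)).

Lemma word_eq_repr (u : word X) : word_eq R (repr (\pi_presented u)) u.
Proof. by apply/presentedP; rewrite reprK. Qed.

Lemma pi_mul (u v : word X) :
  presented_mul (\pi_presented u) (\pi_presented v) = \pi_presented (u ++ v).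
Proof. by apply/presentedP; apply: WordCat; exact: word_eq_repr. Qed.

Lemma inv_wordK : involutive (@inv_word X).
Proof.
move=> u; rewrite /inv_word map_rev revK -map_comp -[RHS]map_id.
by apply: eq_map => -[x b] /=; rewrite negbK.
Qed.

Lemma cat_inv_word (u : word X) : word_eq R (u ++ inv_word u) [::].
Proof.
elim: u => [|[x b] u IHu]; first exact: WordRefl.
rewrite /inv_word /= rev_cons -cats1 -/(inv_word u).
apply: (WordTrans (v := [:: (x, b)] ++ [:: (x, ~~ b)])); last exact: WordCancel.
rewrite -[X in word_eq R X]/([:: (x, b)] ++ (u ++ (inv_word u ++ _))) (catA u).
apply: (WordCat (WordRefl _ _)); rewrite -[X in word_eq R _ X]cat0s.
by apply: WordCat => //; exact: WordRefl.
Qed.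

Lemma presented_mulA : associative presented_mul.
Proof.
move=> a b c; rewrite -(reprK a) -(reprK b) -(reprK c).
move: (repr a) (repr b) (repr c) => u v w.
by rewrite (pi_mul v w) (pi_mul u (v ++ w)) (pi_mul u v) (pi_mul (u ++ v)) catA.
Qed.

Lemma presented_mul1 : left_id presented_one presented_mul.
Proof. by move=> a; rewrite -(reprK a) pi_mul. Qed.

Lemma presented_1mul : right_id presented_one presented_mul.
Proof. by move=> a; rewrite -(reprK a) pi_mul cats0. Qed.

Lemma presented_mulV : right_inverse presented_one presented_inv presented_mul.
Proof.
move=> a; rewrite -{1}(reprK a) pi_mul.
by apply/presentedP; exact: cat_inv_word.
Qed.

Lemma presented_Vmul : left_inverse presented_one presented_inv presented_mul.
Proof.
move=> a; rewrite -{2}(reprK a) pi_mul; apply/presentedP.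
by rewrite -{2}(inv_wordK (repr a)); exact: cat_inv_word.
Qed.

HB.instance Definition _ := isGroup.Build presented
  presented_mulA presented_mul1 presented_1mul presented_Vmul presented_mulV.

End PresentedGroup.

Definition thompson_rel : relations nat := fun u v =>
  exists i j : nat, [/\ (i < j)%N,
    u = [:: (i, false); (j, true); (i, true)] & v = [:: (j.+1, true)]].

Definition thompsonF : groupType := presented thompson_rel.

(* Two-sided inverses are unique, so this is the set of bijections. *)
Record permN := PermN {
  permN_fun :> nat -> nat;
  permN_inv : nat -> nat;
  permN_funK : cancel permN_fun permN_inv;
  permN_invK : cancel permN_inv permN_fun
}.

HB.instance Definition _ := gen_eqMixin permN.
HB.instance Definition _ := gen_choiceMixin permN.

Lemma permNP (f g : permN) : f =1 g <-> f = g.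
Proof.
split=> [fg|-> //]; case: f g fg => [f f' fK f'K] [g g' gK g'K] /= fg.
have {fg} efg : f = g by exact: funext.
subst g; have ef' : f' = g'.
  by apply: funext => n; rewrite -{1}(g'K n) fK.
by subst g'; rewrite (Prop_irrelevance fK gK) (Prop_irrelevance f'K g'K).
Qed.

Definition permN_one := @PermN id id (fun=> erefl) (fun=> erefl).
Definition permN_V (f : permN) := PermN (permN_invK f) (permN_funK f).
(* f * g is f \o g, unlike the diagrammatic product of {perm T}. *)
Definition permN_mul (f g : permN) :=
  PermN (can_comp (permN_funK f) (permN_funK g))
        (can_comp (permN_invK g) (permN_invK f)).

Lemma permN_mulA : associative permN_mul.
Proof. by move=> f g h; apply/permNP. Qed.
Lemma permN_mul1 : left_id permN_one permN_mul.
Proof. by move=> f; apply/permNP. Qed.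
Lemma permN_1mul : right_id permN_one permN_mul.
Proof. by move=> f; apply/permNP. Qed.
Lemma permN_mulV : left_inverse permN_one permN_V permN_mul.
Proof. by move=> f; apply/permNP => n /=; rewrite permN_funK. Qed.
Lemma permN_Vmul : right_inverse permN_one permN_V permN_mul.
Proof. by move=> f; apply/permNP => n /=; rewrite permN_invK. Qed.

HB.instance Definition _ := isGroup.Build permN
  permN_mulA permN_mul1 permN_1mul permN_mulV permN_Vmul.

Local Open Scope nat_scope.

Definition rho_fun (n : nat) : nat :=
  if n %% 3 == 0 then (2 * n) %/ 3
  else if n %% 3 == 1 then (4 * n - 1) %/ 3
  else (4 * n + 1) %/ 3.

Definition rho_inv (m : nat) : nat :=
  if ~~ odd m then (3 * m) %/ 2
  else if m %% 4 == 1 then (3 * m + 1) %/ 4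
  else (3 * m - 1) %/ 4.

Lemma rho_funK : cancel rho_fun rho_inv.
Proof.
move=> n; rewrite /rho_fun.
case: (eqVneq (n %% 3) 0) => [e|n0]; last case: (eqVneq (n %% 3) 1) => [e|n1];
  rewrite /rho_inv; case: ifP => ?; try (case: ifP => ?); lia.
Qed.

Lemma rho_invK : cancel rho_inv rho_fun.
Proof.
move=> m; rewrite /rho_inv.
case: ifP => [e|m0]; last case: (eqVneq (m %% 4) 1) => [e|m1];
  rewrite /rho_fun; case: ifP => ?; try (case: ifP => ?); lia.
Qed.

Definition rho : permN := PermN rho_funK rho_invK.

Definition lambda_fun (n : nat) : nat := rho (n + 1) - 1.
Definition lambda_inv (m : nat) : nat := rho_inv (m + 1) - 1.

Lemma lambda_funK : cancel lambda_fun lambda_inv.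
Proof.
move=> n; rewrite /lambda_inv /lambda_fun /= subnK ?rho_funK ?addnK //.
by rewrite /rho_fun; case: ifP => ?; try (case: ifP => ?); lia.
Qed.

Lemma lambda_invK : cancel lambda_inv lambda_fun.
Proof.
move=> m; rewrite /lambda_inv /lambda_fun /= subnK ?rho_invK ?addnK //.
by rewrite /rho_inv; case: ifP => ?; try (case: ifP => ?); lia.
Qed.

Definition lambda : permN := PermN lambda_funK lambda_invK.

Definition alpha : permN := (lambda * rho^-1)%g.

Lemma alphaE (n : nat) :
  alpha n = if ~~ odd n then 2 * n
            else if n %% 4 == 1 then n + 1
            else (n - 1) %/ 2.
Proof.
change (rho_fun (rho_inv n + 1) - 1 = if ~~ odd n then 2 * n
  else if n %% 4 == 1 then n + 1 else (n - 1) %/ 2).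
rewrite /rho_inv; case: ifP => ?; try (case: ifP => ?);
  rewrite /rho_fun; case: ifP => ?; try (case: ifP => ?); lia.
Qed.

Definition star_fun (a b : nat -> nat) (n : nat) : nat :=
  if ~~ odd n then 2 * a (n %/ 2) else 2 * b ((n - 1) %/ 2) + 1.

Lemma star_can (a b a' b' : nat -> nat) :
  cancel a a' -> cancel b b' -> cancel (star_fun a b) (star_fun a' b').
Proof.
move=> aK bK n; rewrite /star_fun; case: (boolP (odd n)) => n2 /=.
- by rewrite addn1 /= mul2n odd_double /= subn1 -mul2n mulKn // bK; lia.
- by rewrite mul2n odd_double /= -mul2n mulKn // aK; lia.
Qed.

Definition star (a b : permN) : permN :=
  PermN (star_can (permN_funK a) (permN_funK b))
        (star_can (permN_invK a) (permN_invK b)).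

(* Main.v *)
(** The associator satisfies [alpha^-1 (1 * g) alpha = 1 * (1 * g)], where [1 * g]
    is Girard's conjunction of the identity with [g]. Hence the elements
    [x_0 = alpha], [x_(n+1) = 1 * x_n] satisfy Thompson's relations and, as
    [x_(n+1) = x_0^-1 x_n x_0] for [n > 0], they generate the same subgroup as
    [alpha] and [1 * alpha]. The relations turn any word into a fraction [p / q]
    of positive words with nondecreasing indices. Such a word acts as
    [alpha^a (1 * g)] with [g] the action of a shorter word: its value at 2 is
    [2 ^ (a + 1)], so the action determines [a], then [g], and recursively the
    whole word. Hence [p / q] acts trivially only if [p = q]. *)

Require Import Defs.
From HB Require Import structures.
From mathcomp Require Import all_boot zify.
From mathcomp Require Import boolp classical_sets.

Set Implicit Arguments.
Unset Strict Implicit.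
Unset Printing Implicit Defensive.

Local Open Scope group_scope.

(** * Evaluation of words and the universal property of a presentation *)

Definition eval_word (X : Type) (G : groupType) (y : X -> G) (w : word X) : G :=
  \prod_(a <- w) (if a.2 then y a.1 else (y a.1)^-1).

Lemma eval_word_eq (X : Type) (G : groupType) (y : X -> G) (R : relations X) :
  (forall u v, R u v -> eval_word y u = eval_word y v) ->
  forall u v, word_eq R u v -> eval_word y u = eval_word y v.
Proof.
move=> yR u v; elim=> {u v} [u v /yR //|x b|u u' v v' _ IHu _ IHv|//|u v _ ->//|].
- by rewrite /eval_word big_cons big_seq1 big_nil; case: b; rewrite (mulgV, mulVg).
- by rewrite /eval_word !big_cat; congr (_ * _).
- by move=> u v w _ -> _ ->.
Qed.

Definition presented_gen (X : choiceType) (R : relations X) (x : X) :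
  presented R := (\pi_(presented R) [:: (x, true)])%qT.

Lemma pi_cat (X : choiceType) (R : relations X) (u v : word X) :
  \pi_(presented R)%qT (u ++ v) = \pi_(presented R)%qT u * \pi_(presented R)%qT v.
Proof. by rewrite -pi_mul. Qed.

Lemma eval_presented_gen (X : choiceType) (R : relations X) (w : word X) :
  eval_word (@presented_gen X R) w = (\pi_(presented R) w)%qT.
Proof.
elim: w => [|[x b] w IHw]; first by rewrite /eval_word big_nil.
rewrite /eval_word big_cons [X in _ * X]IHw -(cat1s _ w) pi_cat; congr (_ * _).
case: b => //=; apply/mulg1_eq; rewrite -pi_cat; apply/presentedP.
exact: (WordCancel R x true).
Qed.

(** Von Dyck's theorem: evaluation respects [word_eq], so evaluating any representative gives a
    well-defined morphism. *)
Lemma presented_lift (X : choiceType) (R : relations X) (G : groupType)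
    (y : X -> G) :
  (forall u v, R u v -> eval_word y u = eval_word y v) ->
  exists h : UMagmaMorphism.type (presented R) G,
    forall x, h (presented_gen R x) = y x.
Proof.
move=> yR; pose h (a : presented R) := eval_word y (repr a)%qT.
have hpi w : h (\pi_(presented R) w)%qT = eval_word y w.
  exact/(eval_word_eq yR)/word_eq_repr.
have h1 : h 1 = 1 by rewrite [LHS]hpi /eval_word big_nil.
have hM : {morph h : a b / a * b}.
  move=> a b; rewrite -[a]reprK -[b]reprK -pi_cat !hpi.
  exact: big_cat.
exists (HB.pack_for (UMagmaMorphism.type (presented R) G) h
  (isUMagmaMorphism.Build _ _ h (conj h1 hM))) => x /=.
by rewrite hpi /eval_word big_seq1.
Qed.

(** * Fractions of sorted positive words *)

Section ThompsonFractions.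
Variables (G : groupType) (y : nat -> G).
Hypothesis yJ : forall i j, i < j -> y j ^ y i = y j.+1.

Let P (s : seq nat) := \prod_(i <- s) y i.

Lemma thompson_swap i j : i < j -> y j * y i = y i * y j.+1.
Proof. by move=> /yJ <-; rewrite conjgE mulVKg. Qed.

(** The letter [y i] moves right past each smaller letter, its index growing by one each time, so it
    never falls below the bound [j]; the bound keeps the result sorted when [k] is put back in
    front. *)
Lemma thompson_insert i s j : path leq j s -> j <= i ->
  exists2 t, path leq j t & y i * P s = P t.
Proof.
elim: s i j => [|k s IHs] i j /=.
  by move=> _ ji; exists [:: i]; rewrite /= ?ji // /P big_nil big_seq1 mulg1.
move=> /andP[jk ks] ji; case: (leqP i k) => [ik|ki].
  by exists [:: i, k & s]; rewrite /= ?ji ?ik // /P !big_cons.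
have [t kt Pt] := IHs i.+1 k ks (leqW (ltnW ki)).
exists (k :: t); first by rewrite /= jk.
by rewrite /P !big_cons mulgA thompson_swap // -mulgA; congr (_ * _).
Qed.

Lemma thompson_sort s : exists2 t, sorted leq t & P s = P t.
Proof.
suff [t t0 ->] : exists2 t, path leq 0 t & P s = P t.
  by exists t => //; exact: path_sorted t0.
elim: s => [|i s [t t0 st]]; first by exists [::].
have [t' t'0 tt'] := thompson_insert t0 (leq0n i).
by exists t' => //; rewrite -tt' -st /P big_cons.
Qed.

(** An inverse letter crosses [y j] by [(y i)^-1 * y j = y j.+1 * (y i)^-1] if [i < j], by
    [(y i)^-1 * y j = y j * (y i.+1)^-1] if [j < i], and cancels if [i = j]. *)
Lemma thompson_divl i p :
  exists p' q, (y i)^-1 * P p = P p' / P q.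
Proof.
elim: p i => [|j p IHp] i.
  by exists [::], [:: i]; rewrite /P big_seq1 !big_nil mulg1 mul1g.
rewrite /P big_cons -/(P p); have [ij|ji|<-] := ltngtP i j.
- have [p' [q e]] := IHp i; exists (j.+1 :: p'), q.
  by rewrite /P big_cons -/(P p') -mulgA -e -(yJ ij) conjgE !mulgA mulgK.
- have [p' [q e]] := IHp i.+1; exists (j :: p'), q.
  rewrite /P big_cons -/(P p') -mulgA -e -(yJ ji) conjgE !invgM invgK !mulgA.
  by rewrite mulgV mul1g.
- by exists p, [::]; rewrite /P big_nil divg1 mulKg.
Qed.

Lemma thompson_fraction (w : word nat) :
  exists p q, [/\ sorted leq p, sorted leq q & eval_word y w = P p / P q].
Proof.
suff [p [q ->]] : exists p q, eval_word y w = P p / P q.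
  have [p' sp ->] := thompson_sort p; have [q' sq ->] := thompson_sort q.
  by exists p', q'.
elim: w => [|[i b] w [p [q IHw]]].
  by exists [::], [::]; rewrite /eval_word /P !big_nil divg1.
rewrite /eval_word big_cons -/(eval_word y w) {}IHw mulgA; case: b => /=.
  by exists (i :: p), q; rewrite /P big_cons.
have [p' [q' ->]] := thompson_divl i p; exists p', (q ++ q').
by rewrite -mulgA -invgM /P big_cat.
Qed.

End ThompsonFractions.

(** * Girard's conjunction and the action of the associator *)

Lemma permN_mulE (f g : permN) (n : nat) : (f * g) n = f (g n).
Proof. by []. Qed.

Lemma permN_oneE (n : nat) : (1 : permN) n = n.
Proof. by []. Qed.

Lemma parityP (P : nat -> Prop) :
  (forall k, P k.*2) -> (forall k, P k.*2.+1) -> forall n, P n.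
Proof.
by move=> P0 P1 n; rewrite -(odd_double_half n); case: (odd n); [exact: P1 | exact: P0].
Qed.

Lemma star_double (a b : permN) (k : nat) : star a b k.*2 = (a k).*2.
Proof. by rewrite /= /star_fun odd_double /= divn2 doubleK mul2n. Qed.

Lemma star_doubleS (a b : permN) (k : nat) : star a b k.*2.+1 = (b k).*2.+1.
Proof.
by rewrite /= /star_fun /= odd_double /= subn1 /= divn2 doubleK mul2n addn1.
Qed.

Lemma starM (a b c d : permN) : star a b * star c d = star (a * c) (b * d).
Proof.
by apply/permNP; elim/parityP => k; rewrite !(permN_mulE, star_double, star_doubleS).
Qed.

Lemma star11 : star 1 1 = 1.
Proof. by apply/permNP; elim/parityP => k; rewrite (star_double, star_doubleS). Qed.

Lemma star1_conj (a b : permN) : star 1 (a ^ b) = star 1 a ^ star 1 b.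
Proof.
by apply: (mulgI (star 1 b)); rewrite starM mulg1 !conjgE !mulVKg starM mulg1.
Qed.

Lemma star1_inj : injective (star 1).
Proof.
move=> a b /permNP ab; apply/permNP => n.
by have := ab n.*2.+1; rewrite !star_doubleS => -[/double_inj].
Qed.

(* Read binary expansions from the least significant digit: [alpha] is the
   prefix rewriting 0 -> 00, 10 -> 01, 11 -> 1, and [star 1 g] is [g] applied
   behind the prefix 1. *)
Lemma alpha_0 (k : nat) : alpha k.*2 = k.*2.*2.
Proof. by rewrite alphaE odd_double mul2n. Qed.

Lemma alpha_10 (k : nat) : alpha k.*2.*2.+1 = k.*2.+1.*2.
Proof. by rewrite alphaE oddS odd_double /=; case: ifP; lia. Qed.

Lemma alpha_11 (k : nat) : alpha k.*2.+1.*2.+1 = k.*2.+1.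
Proof. by rewrite alphaE oddS odd_double /=; case: ifP; lia. Qed.

(** [alpha] shortens the prefix 11 to 1, and sends the prefixes 0 and 10, behind which
    [star 1 (star 1 g)] does nothing, to even numbers, which [star 1 g] fixes. *)
Lemma star1J (g : permN) : star 1 g ^ alpha = star 1 (star 1 g).
Proof.
apply: (mulgI alpha); rewrite conjgE mulVKg; apply/permNP => n.
rewrite [LHS]permN_mulE [RHS]permN_mulE.
elim/parityP: n => [k|]; last elim/parityP => k.
- by rewrite star_double !permN_oneE !alpha_0 star_double.
- by rewrite alpha_10 !(star_double, star_doubleS) !permN_oneE alpha_10.
- by rewrite alpha_11 !star_doubleS alpha_11.
Qed.

(** * Thompson's generators as permutations; sorted words are determined by their action *)

Definition thompson_perm (n : nat) : permN := iter n (star 1) alpha.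

Lemma thompson_permJ i j : i < j ->
  thompson_perm j ^ thompson_perm i = thompson_perm j.+1.
Proof.
elim: i j => [|i IHi] [|j] //; first by move=> _; exact: star1J.
by move=> /IHi ij; rewrite -[RHS]/(star 1 (thompson_perm j.+1)) -[in RHS]ij star1_conj.
Qed.

Lemma thompson_perm_map_succ s :
  \prod_(i <- map S s) thompson_perm i = star 1 (\prod_(i <- s) thompson_perm i).
Proof.
rewrite big_map; apply/esym; apply: big_morph; last exact: star11.
by move=> a b; rewrite starM mul1g.
Qed.

(** [alpha] doubles even numbers; the base point is 2 because 0 is fixed. *)
Lemma alphaX_2 a : (alpha ^+ a) 2 = (2 ^ a.+1)%N.
Proof.
elim: a => // a IHa; rewrite expgS; change (alpha ((alpha ^+ a) 2) = 2 ^ a.+2)%N.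
by rewrite IHa alphaE oddX /= -expnS.
Qed.

(** The zeros of a sorted word come first, and all later indices are positive, hence successors. *)
Lemma sorted_nseq0_succ (s : seq nat) : sorted leq s ->
  exists a s', sorted leq s' /\ s = nseq a 0 ++ map S s'.
Proof.
elim: s => [|[|n] s IHs] ss; first by exists 0, [::].
  have [a [s' [ss' ->]]] := IHs (path_sorted ss).
  by exists a.+1, s'.
exists 0, (map predn (n.+1 :: s)); split.
  by apply: homo_sorted ss => i j; lia.
rewrite -map_comp map_id_in // => i; rewrite inE => /predU1P[-> //|si].
by have /allP/(_ i si) := order_path_min leq_trans ss; case: i {si}.
Qed.

Lemma thompson_perm_sorted_inj s t : sorted leq s -> sorted leq t ->
  \prod_(i <- s) thompson_perm i = \prod_(i <- t) thompson_perm i -> s = t.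
Proof.
have prod_nseq0 a u :
    \prod_(i <- nseq a 0 ++ map S u) thompson_perm i =
    alpha ^+ a * star 1 (\prod_(i <- u) thompson_perm i).
  rewrite big_cat thompson_perm_map_succ; congr (_ * _).
  by elim: a => [|a IHa]; rewrite ?big_nil // big_cons IHa expgS.
(* Since 2 is even, [star 1 g] fixes it. *)
have at2 a g : (alpha ^+ a * star 1 g) 2 = (2 ^ a.+1)%N by exact: alphaX_2.
(* The induction is on a strict bound for the indices: unshifting lowers it, whereas the length
   stays the same if no index is 0. *)
have [n] : exists n, all (ltn^~ n) (s ++ t).
  exists (foldr maxn 0 (s ++ t)).+1; elim: (s ++ t) => //= i u /allP IHu.
  rewrite ltnS leq_max leqnn /=; apply/allP => j /IHu; lia.
elim: n s t => [|n IHn] s t; first by case: s => //; case: t.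
move=> bst /sorted_nseq0_succ[a [s' [ss' es]]].
move=> /sorted_nseq0_succ[b [t' [st' et]]]; move: bst.
rewrite es et !prod_nseq0 => + est.
have ab : a = b.
  apply/succn_inj/(@expnI 2) => //.
  by rewrite -(at2 _ (\prod_(i <- s') thompson_perm i)) est at2.
move: est; rewrite ab => /mulgI/star1_inj est.
rewrite !all_cat !all_map => /andP[/andP[_ bs] /andP[_ bt]].
by rewrite (IHn s' t') // all_cat; apply/andP.
Qed.

Lemma gen_setM (G : groupType) (A : set G) (u v : G) :
  gen_set A u -> gen_set A v -> gen_set A (u * v).
Proof.
have := group_closedM (gen_set_closed A) (x := u) (y := v).
by rewrite !inE.
Qed.

Lemma gen_setV (G : groupType) (A : set G) (u : G) :
  gen_set A u -> gen_set A u^-1.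
Proof.
by have := group_closedV (gen_set_closed A) (x := u); rewrite !inE.
Qed.

Lemma gen_set1 (G : groupType) (A : set G) : gen_set A 1.
Proof. by have [] := gen_set_closed A; rewrite inE. Qed.

Lemma gen_set_sub (G : groupType) (A H : set G) :
  group_closed [in H] -> (A `<=` H -> gen_set A `<=` H)%classic.
Proof. by move=> cH AH x; apply. Qed.

Lemma sub_gen_set (G : groupType) (A : set G) : (A `<=` gen_set A)%classic.
Proof. by move=> x Ax H [_]; apply. Qed.

Lemma thompson_perm_gen n :
  gen_set [set alpha; star 1 alpha]%classic (thompson_perm n).
Proof.
have a_gen : gen_set [set alpha; star 1 alpha]%classic alpha.
  by apply: sub_gen_set; left.
elim: n => [//|[_|n IHn]]; first by apply: sub_gen_set; right.
rewrite -(@thompson_permJ 0 n.+1) // conjgE.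
by apply: gen_setM; [exact: gen_setV | exact: gen_setM].
Qed.

(** The isomorphism is the inverse of [h] on its range; injectivity of [h] makes the chosen
    preimages multiplicative. *)
Lemma isomorphic_gen_group (H G : groupType) (A : set G)
    (h : {multiplicative H -> G}) :
  injective h -> range h = gen_set A -> isomorphic (gen_group A) H.
Proof.
move=> h_inj hA.
have preim (x : gen_group A) : exists a, h a == val x.
  have : range h (val x) by rewrite hA; have := valP x; rewrite inE.
  by case=> a _ /eqP; exists a.
pose f x := xchoose (preim x).
have hf x : h (f x) = val x by exact/eqP/(xchooseP (preim x)).
have fM : {morph f : x y / x * y}.
  by move=> x y; apply: h_inj; rewrite gmulfM !hf.
exists (HB.pack_for {multiplicative gen_group A -> H} f
  (isMultiplicative.Build _ _ f fM)) => /=.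
have h_gen a : h a \in gen_set A by rewrite inE -hA; exists a.
exists (fun a => Sub (h a) (h_gen a)) => [x|a].
  by apply: val_inj; rewrite SubK hf.
by apply: h_inj; rewrite hf SubK.
Qed.

(** This allows fractions to be formed in [thompsonF] itself, before applying the morphism to
    permutations. *)
Lemma thompsonF_relJ i j : i < j ->
  presented_gen thompson_rel j ^ presented_gen thompson_rel i =
  presented_gen thompson_rel j.+1.
Proof.
move=> ij; have ->: presented_gen thompson_rel j.+1 =
    \pi_(thompsonF)%qT [:: (i, false); (j, true); (i, true)].
  by apply/presentedP/WordSym/WordRel; exists i, j.
rewrite -eval_presented_gen /eval_word !big_cons big_nil mulg1 /=.
by rewrite conjgE.
Qed.

Theorem theorem10 :
  isomorphic (gen_group [set alpha; star 1%g alpha]%classic) thompsonF.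
Proof.
have [u v [i [j [ij -> ->]]]|h hx] :=
    @presented_lift _ thompson_rel _ thompson_perm.
  by rewrite /eval_word !big_cons !big_nil !mulg1; exact: thompson_permJ.
have fracF (a : thompsonF) : exists p q, [/\ sorted leq p, sorted leq q &
    a = \prod_(i <- p) presented_gen thompson_rel i /
        \prod_(i <- q) presented_gen thompson_rel i].
  have [p [q [sp sq e]]] := thompson_fraction thompsonF_relJ (repr a)%qT.
  by exists p, q; split => //; rewrite -e eval_presented_gen reprK.
have h_prod s : h (\prod_(i <- s) presented_gen thompson_rel i) =
    \prod_(i <- s) thompson_perm i.
  by rewrite gmulf_prod; apply: eq_bigr => i _.
apply: (@isomorphic_gen_group _ _ _ h).
  apply: gmulf_inj => a; have [p [q [sp sq ->]]] := fracF a.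
  rewrite gmulfF !h_prod => /divg1_eq /thompson_perm_sorted_inj ->//.
  by rewrite mulgV.
apply/seteqP; split=> [_ [a _ <-]|].
  have [p [q [_ _ ->]]] := fracF a; rewrite gmulfF !h_prod.
  have gen s : gen_set [set alpha; star 1 alpha]%classic
      (\prod_(i <- s) thompson_perm i).
    apply: big_ind => [|u v|i _]; [exact: gen_set1 | exact: gen_setM |].
    exact: thompson_perm_gen.
  by apply: gen_setM => //; exact: gen_setV.
(* Conversely, the range is a subgroup containing both generators, the images of [x_0] and [x_1]. *)
apply: gen_set_sub => [|_ [->|->]].
- split=> [|u v]; rewrite !inE; first by exists (1 : thompsonF); rewrite ?gmulf1.
  by case=> a _ <- [b _ <-]; exists (a / b : thompsonF); rewrite ?gmulfF.
- by exists (presented_gen thompson_rel 0); rewrite ?hx.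
- by exists (presented_gen thompson_rel 1%N); rewrite ?hx.
Qed.
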